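(* Let $p,q,r\in(0,1)$ with $p+q+r=1$. Let $X_1,\eta_2,\eta_3,\ldots$ be independent random variables, each taking the values $1,-1,0$ with probabilities $p,q,r$ respectively. Set $X_{n+1}=\eta_{n+1}X_1$ for $n\ge1$ and $S_n=\sum_{k=1}^nX_k$. Then, as $n\to\infty$: (a) $\dfrac{S_n-n(p-q)X_1}{\sqrt{n\,(p+q-(p-q)^2)}}$ converges in distribution to the law with distribution function $F(x)=(p+q)\Phi(x)+r\,\mathbf 1\{x\ge0\}$, where $\Phi$ is the standard normal distribution function; (b) $\dfrac{S_n-n(p-q)X_1}{n}\to0$ almost surely.
   Context: This is the elephant random walk with delays in which the elephant remembers only the first step. The limit in (a) is the mixture $(p+q)\mathcal N_{0,1}+r\delta_0$ of a standard normal law and a point mass at $0$. *)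

(* Defs.v *)
From HB Require Import structures.
From mathcomp Require Import all_boot all_order all_algebra.
From mathcomp Require Import all_classical all_reals all_analysis.
From mathcomp Require Import normal_distribution.
Set Implicit Arguments. Unset Strict Implicit. Unset Printing Implicit Defensive.
Import Order.TTheory GRing.Theory Num.Theory.
Import numFieldNormedType.Exports.
Local Open Scope classical_set_scope.
Local Open Scope ring_scope.

Definition mutually_independent {d} {T : measurableType d} {R : realType}
  (P : probability T R) (Y : nat -> T -> R) : Prop :=
  forall (I : seq nat) (B : nat -> set R),
    uniq I -> (forall i, measurable (B i)) ->
    P (\big[setI/setT]_(i <- I) (Y i @^-1` B i)) =
    (\prod_(i <- I) P (Y i @^-1` B i))%E.

Definition three_point_law {d} {T : measurableType d} {R : realType}
  (P : probability T R) (Z : T -> R) (p q r : R) : Prop :=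
  [/\ P (Z @^-1` [set 1]) = p%:E, P (Z @^-1` [set -1]) = q%:E
    & P (Z @^-1` [set 0]) = r%:E].

(* The family X_1, eta_2, eta_3, ... reindexed from 0. *)
Definition erw_family {T R : Type} (X1 : T -> R) (eta : nat -> T -> R) :
  nat -> T -> R := fun k => if k == 0%N then X1 else eta k.+1.

Definition erw_step {T : Type} {R : pzRingType} (X1 : T -> R) (eta : nat -> T -> R)
  (k : nat) : T -> R := fun w => if (k <= 1)%N then X1 w else eta k w * X1 w.

Definition erw_sum {T : Type} {R : pzRingType} (X1 : T -> R) (eta : nat -> T -> R)
  (n : nat) : T -> R := fun w => \sum_(1 <= k < n.+1) erw_step X1 eta k w.

Definition std_normal_cdf {R : realType} (x : R) : R :=
  fine (normal_prob 0 1 `]-oo, x]).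

Definition cvg_in_distribution {d} {T : measurableType d} {R : realType}
  (P : probability T R) (W : nat -> T -> R) (F : R -> R) : Prop :=
  forall x : R, {for x, continuous F} ->
    (fun n => fine (P (W n @^-1` `]-oo, x]))) @ \oo --> F x.

(* Main.v *)
(* With m = p - q one has S_n - n m X_1 = X_1 U_n, where
   U_n = 1 - m + sum_(2 <= k <= n) (eta_k - m) is a centred random walk independent
   of X_1.  Its law is computed by iterating the one-step averaging operator A, so
   both claims become statements about the powers A^n.
   (a) The function heat s x y = Phi ((x - y) / sqrt s) solves the heat equation, and
   a Taylor expansion gives A (heat s x) = heat (s + v) x + O(s^(-3/2)), v being the
   variance of a step.  Telescoping compares A^n (heat s x) with heat (s + n v) x;
   with s a small multiple of n v, heat s x approximates the indicator of ]-oo, x] on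
   the scale sqrt n, and the central limit theorem for U_n follows.  Conditioning on X_1 = 1, -1, 0 gives the mixture.
   (b) Exponentials are eigenfunctions of A, which yields an exponential tail bound for
   U_n / n; the Borel-Cantelli lemma concludes. *)
Require Import Defs.
From HB Require Import structures.
From mathcomp Require Import all_boot all_order all_algebra.
From mathcomp Require Import all_classical all_reals all_analysis.
From mathcomp Require Import normal_distribution measurable_realfun.
From mathcomp Require Import ring lra.

Set Implicit Arguments.
Unset Strict Implicit.
Unset Printing Implicit Defensive.

Import Order.TTheory GRing.Theory Num.Theory.
Import numFieldNormedType.Exports.
Local Open Scope classical_set_scope.
Local Open Scope ring_scope.

(** * Mean value and Taylor estimates with explicit constants *)

Lemma le_norm_increment (R : realType) (f df : R -> R) (M x h : R) :
  (forall t : R, is_derive t 1 f (df t)) ->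
  (forall t, `|t - x| <= `|h| -> `|df t| <= M) ->
  `|f (x + h) - f x| <= M * `|h|.
Proof.
move=> fdf dfM.
have cf : continuous f.
  by move=> t; apply: differentiable_continuous; apply/derivable1_diffP; case: (fdf t).
have [h0|h0] := lerP 0 h.
- have [||c cxh ->] := @MVT_segment R f df x (x + h).
  + by rewrite lerDl.
  + exact: continuous_subspaceT.
  rewrite addrC addKr normrM ler_wpM2r//; apply: dfM.
  move: cxh; rewrite in_itv/= => /andP[xc ch].
  by rewrite !ger0_norm ?subr_ge0//; lra.
- rewrite distrC.
  have [||c cxh ->] := @MVT_segment R f df (x + h) x.
  + by lra.
  + exact: continuous_subspaceT.
  rewrite opprD addNKr normrM normrN ler_wpM2r//; apply: dfM.
  move: cxh; rewrite in_itv/= => /andP[xc ch].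
  by rewrite (ler0_norm (ltW h0)) ler0_norm ?subr_le0//; lra.
Qed.

(** Once the tangent at [x] is subtracted, the derivative [f1 t - f1 x] is at most [M * |h|] within
    distance [|h|] of [x], by the mean value inequality. A second use of that inequality gives the
    bound, without the sharp factor 1/2. *)
Lemma taylor_order1 (R : realType) (f f1 f2 : R -> R) (M : R) :
  (forall t : R, is_derive t 1 f (f1 t)) -> (forall t : R, is_derive t 1 f1 (f2 t)) ->
  (forall t, `|f2 t| <= M) ->
  forall x h, `|f (x + h) - f x - h * f1 x| <= M * h ^+ 2.
Proof.
move=> df df1 f2M x h.
have M0 : 0 <= M by apply: le_trans (f2M 0).
pose F t := f t - t * f1 x.
have dF (t : R) : is_derive t 1 F (f1 t - f1 x).
  rewrite /F; apply: is_deriveB.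
  by apply: is_derive_eq; rewrite /GRing.scale/=; ring.
have := @le_norm_increment R F _ (M * `|h|) x h dF.
rewrite /F -mulrA -expr2 -normrX (ger0_norm (sqr_ge0 h)).
have -> : f (x + h) - (x + h) * f1 x - (f x - x * f1 x) =
  f (x + h) - f x - h * f1 x by ring.
apply=> t th; rewrite -{1}(subrKC x t).
apply: le_trans (_ : _ <= M * `|t - x|) _; last by rewrite ler_wpM2l.
by apply: (@le_norm_increment R f1 f2).
Qed.

(** The same device one order higher: after subtracting the quadratic part of the expansion, the
    derivative is the first-order remainder of [f1]. *)
Lemma taylor_order2 (R : realType) (f f1 f2 f3 : R -> R) (M : R) :
  (forall t : R, is_derive t 1 f (f1 t)) -> (forall t : R, is_derive t 1 f1 (f2 t)) ->
  (forall t : R, is_derive t 1 f2 (f3 t)) -> (forall t, `|f3 t| <= M) ->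
  forall x h, `|f (x + h) - f x - h * f1 x - h ^+ 2 / 2 * f2 x| <= M * `|h| ^+ 3.
Proof.
move=> df df1 df2 f3M x h.
have M0 : 0 <= M by apply: le_trans (f3M 0).
pose F t := f t - (t * f1 x + (t - x) ^+ 2 / 2 * f2 x).
have dF (t : R) : is_derive t 1 F (f1 t - (f1 x + (t - x) * f2 x)).
  rewrite /F; apply: is_deriveB; apply: is_derive_eq.
  by rewrite /GRing.scale/=; field.
have := @le_norm_increment R F _ (M * h ^+ 2) x h dF.
rewrite /F.
have -> : M * h ^+ 2 * `|h| = M * `|h| ^+ 3.
  by rewrite -mulrA -(real_normK (num_real h)) -exprSr.
have -> : f (x + h) - ((x + h) * f1 x + (x + h - x) ^+ 2 / 2 * f2 x)
    - (f x - (x * f1 x + (x - x) ^+ 2 / 2 * f2 x)) =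
  f (x + h) - f x - h * f1 x - h ^+ 2 / 2 * f2 x by ring.
apply=> t th.
have := taylor_order1 df1 df2 f3M x (t - x).
rewrite subrKC => H; rewrite opprD addrA; apply: le_trans H _.
rewrite ler_wpM2l// -(real_normK (num_real (t - x))) -(real_normK (num_real h)).
by rewrite lerXn2r ?nnegrE.
Qed.

(** * Derivatives, bounds and limits of the standard normal distribution function *)

Lemma std_normal_pdfE (R : realType) (x : R) :
  normal_pdf 0 1 x = normal_peak 1 * expR (- (x ^+ 2 / 2)).
Proof.
rewrite normal_pdfE ?oner_neq0//; congr (_ * expR _).
by rewrite subr0 expr1n mulr2n mulNr.
Qed.

Lemma is_derive_std_normal_pdf (R : realType) (x : R) :
  is_derive x 1 (normal_pdf 0 1) (- x * normal_pdf 0 1 x).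
Proof.
have -> : normal_pdf 0 1 = fun x : R => normal_peak 1 * expR (- (x ^+ 2 / 2)).
  by apply/funext => z; exact: std_normal_pdfE.
have d1 : is_derive x 1 (fun x : R => - (x ^+ 2 / 2)) (- x).
  by apply: is_derive_eq; rewrite /GRing.scale/=; field.
have d2 := @is_derive1_comp R expR _ x _ _ (is_derive_expR _) d1.
apply: (is_derive_eq (is_deriveM (is_derive_cst (normal_peak 1) x 1) d2)).
by rewrite /GRing.scale/=; ring.
Qed.

Lemma is_derive_std_normal_pdf' (R : realType) (x : R) :
  is_derive x 1 (fun x => - x * normal_pdf 0 1 x) ((x ^+ 2 - 1) * normal_pdf 0 1 x).
Proof.
have := is_derive_std_normal_pdf x => d.
by apply: is_derive_eq; rewrite /GRing.scale/=; ring.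
Qed.

Lemma normal_peak1_le1 (R : realType) : normal_peak (1 : R) <= 1.
Proof.
rewrite /normal_peak invf_le1 ?sqrtr_gt0; last first.
  by rewrite expr1n mul1r mulrn_wgt0// pi_gt0.
rewrite -[leLHS]sqrtr1 ler_wsqrtr// expr1n mul1r.
by have := pi_ge2 R; lra.
Qed.

(** The inequality [1 + u <= expR u] at [u = x ^+ 2 / 4], squared, is absorbed by the Gaussian. A
    weight of degree 4 suffices for the derivatives used below, whose polynomial factors have degree
    at most 3. *)
Lemma std_normal_pdf_le (R : realType) (x : R) :
  normal_pdf 0 1 x * (1 + x ^+ 2 / 4) ^+ 2 <= 1.
Proof.
have e0 := expR_ge0 (- (x ^+ 2 / 2)).
have xx : 0 <= x ^+ 2 by exact: sqr_ge0.
rewrite std_normal_pdfE -mulrA.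
apply: le_trans (_ : 1 * (expR (- (x ^+ 2 / 2)) * (1 + x ^+ 2 / 4) ^+ 2) <= 1).
  by rewrite ler_wpM2r ?normal_peak1_le1// mulr_ge0// sqr_ge0.
rewrite mul1r expRN ler_pdivrMl ?expR_gt0// mulr1.
have -> : x ^+ 2 / 2 = x ^+ 2 / 4 + x ^+ 2 / 4 by field.
by rewrite expRD -expr2 lerXn2r ?nnegrE ?expR_ge0 ?expR_ge1Dx//; lra.
Qed.

Lemma poly_std_normal_pdf_le (R : realType) (x t : R) :
  `|t| <= 4 * (1 + x ^+ 2 / 4) ^+ 2 -> `|t * normal_pdf 0 1 x| <= 4.
Proof.
move=> tx; rewrite normrM (ger0_norm (normal_pdf_ge0 _ _ _)).
apply: le_trans (ler_wpM2r (normal_pdf_ge0 _ _ _) tx) _.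
by have := std_normal_pdf_le x; lra.
Qed.

Lemma std_normal_pdf_bound1 (R : realType) (x : R) : `|- x * normal_pdf 0 1 x| <= 4.
Proof.
rewrite poly_std_normal_pdf_le// normrN ler_norml.
have := sqr_ge0 x; have := sqr_ge0 (x - 2); have := sqr_ge0 (x + 2).
by move=> ? ? ?; apply/andP; split; nra.
Qed.

Lemma std_normal_pdf_bound2 (R : realType) (x : R) :
  `|(x ^+ 2 - 1) * normal_pdf 0 1 x| <= 4.
Proof.
rewrite poly_std_normal_pdf_le// ler_norml.
have := sqr_ge0 x => ?.
by apply/andP; split; nra.
Qed.

Lemma std_normal_pdf_bound3 (R : realType) (x : R) :
  `|x * (x ^+ 2 - 1) * normal_pdf 0 1 x| <= 4.
Proof.
rewrite poly_std_normal_pdf_le// normrM.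
have x1 : `|x| <= 1 + x ^+ 2 / 4.
  rewrite ler_norml; have := sqr_ge0 (x - 2); have := sqr_ge0 (x + 2).
  by move=> ? ?; apply/andP; split; nra.
have x2 : `|x ^+ 2 - 1| <= 4 * (1 + x ^+ 2 / 4).
  by rewrite ler_norml; have := sqr_ge0 x => ?; apply/andP; split; nra.
by rewrite expr2 mulrCA ler_pM.
Qed.

Lemma is_derive_std_normal_cdf (R : realType) (x : R) :
  is_derive x 1 (@std_normal_cdf R) (normal_pdf 0 1 x).
Proof.
have x1 : x < x + 1 by rewrite ltrDl.
have iphi : lebesgue_measure.-integrable `]-oo, (x + 1)]
    (EFin \o (normal_pdf 0 1 : R -> R)).
  by apply: integrableS (integrable_normal_pdf 0 1).
have [d1 d2] := continuous_FTC1 x1 iphi (ltNyr x)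
  (@continuous_normal_pdf R 0 1 (oner_neq0 R) x).
by apply: DeriveDef; rewrite ?derive1E in d2 *.
Qed.

Lemma std_normal_cdf_homo (R : realType) : {homo @std_normal_cdf R : x y / x <= y}.
Proof.
move=> x y xy; rewrite fine_le ?fin_num_measure// le_measure ?inE//.
exact: subitvPr.
Qed.

Lemma std_normal_cdf_ge0 (R : realType) (x : R) : 0 <= std_normal_cdf x.
Proof. by rewrite fine_ge0. Qed.

Lemma std_normal_cdf_continuous (R : realType) : continuous (@std_normal_cdf R).
Proof.
move=> x; apply: differentiable_continuous; apply/derivable1_diffP.
by case: (is_derive_std_normal_cdf x).
Qed.

(** The identity, made a random variable under the normal law, so that its distribution function is
    [std_normal_cdf] and general limits of distribution functions apply. *)
Definition id_measurableTypeR (R : realType) : measurableTypeR R -> R := idfun.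

HB.instance Definition _ (R : realType) := @isMeasurableFun.Build _ _ _ _
  (@id_measurableTypeR R) (@measurable_id _ _ setT).

Lemma std_normal_cdf_y1 (R : realType) : @std_normal_cdf R x @[x --> +oo] --> (1 : R).
Proof.
pose X : {RV (normal_prob (0:R) 1) >-> R} := @id_measurableTypeR R.
exact: (fine_cvg (@cvg_cdfy1 _ _ _ _ X)).
Qed.

Lemma std_normal_cdf_Ny0 (R : realType) : @std_normal_cdf R x @[x --> -oo] --> (0 : R).
Proof.
pose X : {RV (normal_prob (0:R) 1) >-> R} := @id_measurableTypeR R.
exact: (fine_cvg (@cvg_cdfNy0 _ _ _ _ X)).
Qed.

(** The density is even, so [F] below has zero derivative and is constant; its limit at [+oo] is
    1. *)
Lemma std_normal_cdfN (R : realType) (x : R) :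
  std_normal_cdf (- x) = 1 - std_normal_cdf x.
Proof.
pose F (x : R) := std_normal_cdf x + std_normal_cdf (- x).
have dF (y : R) : is_derive y 1 F 0.
  have d1 : is_derive y 1 (fun y : R => - y) (- 1) by apply: is_derive_eq.
  have d2 := @is_derive1_comp R _ _ y _ _ (is_derive_std_normal_cdf (- y)) d1.
  apply: (is_derive_eq (is_deriveD (is_derive_std_normal_cdf y) d2)).
  by rewrite !std_normal_pdfE sqrrN; ring.
have Fcst y : F y = F x.
  apply/eqP; rewrite -subr_eq0 -normr_le0.
  have := @le_norm_increment R F _ 0 x (y - x) dF.
  by rewrite mul0r subrKC; apply => t _; rewrite normr0.
have : F y @[y --> +oo] --> (1 : R).
  rewrite -[1]addr0; apply: cvgD; first exact: std_normal_cdf_y1.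
  by move/cvgNy_compNP: (@std_normal_cdf_Ny0 R).
have -> : F = cst (F x) by apply/funext => y; exact: Fcst.
move=> /(cvg_unique _ (cvg_cst _)) F1.
by have := F1 (@norm_hausdorff _ _); rewrite /F => <-; ring.
Qed.

(** The third derivative of the distribution function is [(x ^+ 2 - 1) * normal_pdf 0 1 x], bounded
    by 4. *)
Lemma std_normal_cdf_taylor (R : realType) (x h : R) :
  `|std_normal_cdf (x + h) - std_normal_cdf x - h * normal_pdf 0 1 x
    - h ^+ 2 / 2 * (- x * normal_pdf 0 1 x)| <= 4 * `|h| ^+ 3.
Proof.
exact: (taylor_order2 (@is_derive_std_normal_cdf R) (@is_derive_std_normal_pdf R)
  (@is_derive_std_normal_pdf' R) (@std_normal_pdf_bound2 R)).
Qed.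

(** Both bounds come from [1 + t <= expR t], taken at [t = ln (1 + w)] and at its opposite. *)
Lemma ln1D_bounds (R : realType) (w : R) : 0 <= w -> w - w ^+ 2 <= ln (1 + w) <= w.
Proof.
move=> w0; have w1 : 0 < 1 + w by lra.
have e1 := expR_ge1Dx (ln (1 + w)); have e2 := expR_ge1Dx (- ln (1 + w)).
rewrite expRN !lnK ?posrE// in e1 e2.
apply/andP; split; last by lra.
have := ler_wpM2l (ltW w1) e2; rewrite mulfV ?gt_eqF// => e3.
have : ln (1 + w) <= w by lra.
by nra.
Qed.

(* Substituting [1 + w = expR t] makes the derivatives in [t] globally bounded. *)
Lemma std_normal_cdf_rescale (R : realType) (x w : R) : 0 <= w ->
  `|std_normal_cdf (x / Num.sqrt (1 + w)) - std_normal_cdf x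
    - w / 2 * (- x * normal_pdf 0 1 x)| <= 3 * w ^+ 2.
Proof.
move=> w0.
pose k (t : R) := x * expR (- (t / 2)).
have dk (t : R) : is_derive t 1 k (- (k t / 2)).
  have d1 : is_derive t 1 (fun t : R => - (t / 2)) (- (1 / 2)).
    by apply: is_derive_eq; rewrite /GRing.scale/=; field.
  have d2 := @is_derive1_comp R expR _ t _ _ (is_derive_expR _) d1.
  apply: (is_derive_eq (is_deriveM (is_derive_cst x t 1) d2)).
  by rewrite /k /GRing.scale/=; field.
pose g (t : R) := std_normal_cdf (k t).
pose g1 (t : R) := 1 / 2 * (- k t * normal_pdf 0 1 (k t)).
pose g2 (t : R) := - (1 / 4) * (k t * (k t ^+ 2 - 1) * normal_pdf 0 1 (k t)).
have dg (t : R) : is_derive t 1 g (g1 t).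
  have d := @is_derive1_comp R _ _ t _ _ (is_derive_std_normal_cdf (k t)) (dk t).
  by apply: (is_derive_eq d); rewrite /g1; field.
have dg1 (t : R) : is_derive t 1 g1 (g2 t).
  have d := @is_derive1_comp R _ _ t _ _ (is_derive_std_normal_pdf' (k t)) (dk t).
  have d' := is_deriveM (is_derive_cst (1 / 2 : R) t 1) d.
  have {}d' : is_derive t 1 g1 _ := d'.
  apply: (is_derive_eq d').
  by rewrite /g2 /GRing.scale/=; field.
have g2b (t : R) : `|g2 t| <= 1.
  rewrite /g2 normrM normrN (@ger0_norm _ (1 / 4)); last lra.
  by have := std_normal_pdf_bound3 (k t); lra.
have w1 : 0 < 1 + w by lra.
have := taylor_order1 dg dg1 g2b 0 (ln (1 + w)).
have k0 : k 0 = x by rewrite /k mul0r oppr0 expR0 mulr1.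
have klnw : k (ln (1 + w)) = x / Num.sqrt (1 + w).
  have e2 : expR (ln (1 + w) / 2) ^+ 2 = 1 + w.
    by rewrite -expRM_natl mulrC divfK ?pnatr_eq0// lnK.
  by rewrite /k expRN -[in Num.sqrt _]e2 sqrtr_sqr ger0_norm ?expR_ge0.
rewrite add0r /g /g1 k0 klnw.
(* The Taylor remainder is at most [w ^+ 2]. Replacing [ln (1 + w)] by [w] in the linear term costs
   at most [2 * w ^+ 2], since the two differ by at most [w ^+ 2] and the coefficient is at most
   4/2. *)
have /andP[l1 l2] := ln1D_bounds w0.
have := std_normal_pdf_bound1 x.
have : 0 <= ln (1 + w) by rewrite ln_ge0// lerDl.
move: (ln (1 + w)) l1 l2 => t l1 l2 t0.
set D := _ - std_normal_cdf x; move: (- x * _) => e.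
rewrite !ler_norml => /andP[? ?] /andP[? ?].
have ? : t ^+ 2 <= w ^+ 2 by rewrite lerXn2r ?nnegrE.
have ? : (w - t) * e <= (w - t) * 4 by rewrite ler_wpM2l//; lra.
have ? : - ((w - t) * 4) <= (w - t) * e by rewrite -mulrN ler_wpM2l//; lra.
by apply/andP; split; nra.
Qed.

(** * The averaging operator compared with the heat flow *)

Section step_operator.
Variables (R : realType) (p q r a b c : R).
Hypotheses (p0 : 0 <= p) (q0 : 0 <= q) (r0 : 0 <= r) (pqr1 : p + q + r = 1).

(** Transition operator of a walk with jumps [a], [b], [c] of probabilities [p], [q], [r]; its
    [n]-th iterate at [y] is the expectation of [f] after [n] steps from [y]. *)
Definition step_op (f : R -> R) (y : R) : R :=
  p * f (y + a) + q * f (y + b) + r * f (y + c).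

Lemma ler_iter_step_op (f g : R -> R) (n : nat) (y : R) :
  (forall z, f z <= g z) -> iter n step_op f y <= iter n step_op g y.
Proof.
move=> fg; elim: n y => [|n IH] y /=; first exact: fg.
by rewrite /step_op !lerD// ler_wpM2l.
Qed.

Lemma iter_step_opZ (k : R) (f : R -> R) (n : nat) (y : R) :
  iter n step_op (fun z => k * f z) y = k * iter n step_op f y.
Proof. by elim: n y => [//|n IH] y /=; rewrite /step_op !IH; ring. Qed.

Lemma iter_step_op_cst (k : R) (n : nat) (y : R) : iter n step_op (cst k) y = k.
Proof. by elim: n y => [//|n IH] y /=; rewrite /step_op !IH -!mulrDl pqr1 mul1r. Qed.

Lemma step_op_dist (f g : R -> R) (e : R) (y : R) :
  (forall z, `|f z - g z| <= e) -> `|step_op f y - step_op g y| <= e.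
Proof.
move=> fg; rewrite /step_op.
have -> : p * f (y + a) + q * f (y + b) + r * f (y + c)
    - (p * g (y + a) + q * g (y + b) + r * g (y + c)) =
  p * (f (y + a) - g (y + a)) + q * (f (y + b) - g (y + b))
    + r * (f (y + c) - g (y + c)) by ring.
have -> : e = p * e + q * e + r * e by rewrite -!mulrDl pqr1 mul1r.
rewrite (le_trans (ler_normD _ _))// lerD//; last first.
  by rewrite normrM (ger0_norm r0) ler_wpM2l.
by rewrite (le_trans (ler_normD _ _))// lerD// normrM (ger0_norm, ger0_norm)// ler_wpM2l.
Qed.

Hypothesis mean0 : p * a + q * b + r * c = 0.

Definition step_var : R := p * a ^+ 2 + q * b ^+ 2 + r * c ^+ 2.

(** The term with third absolute moments carries the Taylor constant of the space variable; the term
    with [step_var ^+ 2] carries the constant of the change of variance. *)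
Definition step_err : R :=
  4 * (p * `|a| ^+ 3 + q * `|b| ^+ 3 + r * `|c| ^+ 3) + 3 * step_var ^+ 2.

Lemma step_var_ge0 : 0 <= step_var.
Proof. by rewrite /step_var !addr_ge0// mulr_ge0// sqr_ge0. Qed.

Lemma step_err_ge0 : 0 <= step_err.
Proof.
by rewrite /step_err addr_ge0// mulr_ge0// ?sqr_ge0// !addr_ge0// mulr_ge0//
  exprn_ge0.
Qed.

(** Probability that a normal variable of mean [y] and variance [s] is at most [x]: a smoothing of
    the indicator of []-oo, x]] on the scale [Num.sqrt s]. *)
Definition heat (s x y : R) : R := std_normal_cdf ((x - y) / Num.sqrt s).

(** Averaging over a centred step kills the first-order term, and the second-order term equals the
    effect of raising the variance by [step_var]. Only third-order errors in [1 / Num.sqrt s]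
    remain. *)
Lemma step_op_heat (s x y : R) : 1 <= s ->
  `|step_op (heat s x) y - heat (s + step_var) x y| <= step_err / Num.sqrt s ^+ 3.
Proof.
move=> s1; have s0 : 0 < s by lra.
have ss0 : 0 < Num.sqrt s by rewrite sqrtr_gt0.
set d := (Num.sqrt s)^-1; have d0 : 0 <= d by rewrite invr_ge0 ltW.
have d1 : d <= 1 by rewrite invf_le1// -[leLHS]sqrtr1 ler_wsqrtr.
have dE : d ^+ 2 = s^-1 by rewrite exprVn sqr_sqrtr// ltW.
set z := (x - y) * d.
have hE h : heat s x (y + h) = std_normal_cdf (z - h * d).
  by rewrite /heat -/d /z; congr std_normal_cdf; ring.
have vE : heat (s + step_var) x y = std_normal_cdf (z / Num.sqrt (1 + step_var * d ^+ 2)).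
  rewrite /heat; congr std_normal_cdf; rewrite /z -mulrA; congr (_ * _).
  have -> : s + step_var = s * (1 + step_var * d ^+ 2).
    by rewrite dE; field; rewrite gt_eqF.
  by rewrite sqrtrM ?(ltW s0)// invfM.
rewrite /step_op !hE vE -exprVn -/d.
have v0 : 0 <= step_var * d ^+ 2 by rewrite mulr_ge0 ?step_var_ge0// sqr_ge0.
have := std_normal_cdf_rescale z v0.
have := std_normal_cdf_taylor z (- (a * d)).
have := std_normal_cdf_taylor z (- (b * d)).
have := std_normal_cdf_taylor z (- (c * d)).
rewrite !normrN !normrM (ger0_norm d0) !exprMn.
rewrite /step_err.
have := step_var_ge0; have vdef : step_var = p * a ^+ 2 + q * b ^+ 2 + r * c ^+ 2 by [].
move: step_var vdef v0 => v vdef v0 vge0.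
set Fa := std_normal_cdf (z - a * d); set Fb := std_normal_cdf (z - b * d).
set Fc := std_normal_cdf (z - c * d); set F := std_normal_cdf z.
set Fv := std_normal_cdf (z / _); set f1 := normal_pdf 0 1 z; set f2 := - z * f1.
move: (`|a| ^+ 3) (`|b| ^+ 3) (`|c| ^+ 3) => A3 B3 C3.
move=> hc hb ha hv.
(* The expansion terms inserted here cancel: order 0 by [pqr1], order 1 by [mean0], order 2 by the
   definition of the variance. *)
have -> : p * Fa + q * Fb + r * Fc - Fv =
    p * (Fa - F - - (a * d) * f1 - (- (a * d)) ^+ 2 / 2 * f2)
  + q * (Fb - F - - (b * d) * f1 - (- (b * d)) ^+ 2 / 2 * f2)
  + r * (Fc - F - - (c * d) * f1 - (- (c * d)) ^+ 2 / 2 * f2)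
  - (Fv - F - v * d ^+ 2 / 2 * f2).
  apply/eqP; rewrite -subr_eq0; apply/eqP.
  rewrite [LHS](_ : _ = (p + q + r - 1) * F - d * f1 * (p * a + q * b + r * c)
     + d ^+ 2 / 2 * f2 * (p * a ^+ 2 + q * b ^+ 2 + r * c ^+ 2 - v)); last by field.
  by rewrite pqr1 mean0 vdef !subrr mul0r !mulr0 subr0 addr0.
rewrite (le_trans (ler_normB _ _))// mulrDl lerD//; last first.
  apply: le_trans hv _.
  rewrite -[leRHS]mulrA ler_wpM2l// ler_wpM2l ?sqr_ge0//.
  (* The change of variance gives an error of order [d ^+ 4], which is at most [d ^+ 3] because
     [s >= 1]. *)
  by rewrite -exprD ler_wiXn2l.
have -> : 4 * (p * A3 + q * B3 + r * C3) * d ^+ 3 =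
  p * (4 * (A3 * d ^+ 3)) + q * (4 * (B3 * d ^+ 3)) + r * (4 * (C3 * d ^+ 3)) by ring.
rewrite (le_trans (ler_normD _ _))// lerD//; last first.
  by rewrite normrM (ger0_norm r0) ler_wpM2l.
rewrite (le_trans (ler_normD _ _))// lerD//.
  by rewrite normrM (ger0_norm p0) ler_wpM2l.
by rewrite normrM (ger0_norm q0) ler_wpM2l.
Qed.

(** Averaging does not increase uniform distance, so the one-step errors add up; each is at most the
    first one, since the variance only grows. *)
Lemma iter_step_op_heat (n : nat) (s x y : R) : 1 <= s ->
  `|iter n step_op (heat s x) y - heat (s + n%:R * step_var) x y|
    <= n%:R * (step_err / Num.sqrt s ^+ 3).
Proof.
move=> s1; elim: n y => [|n IH] y /=; first by rewrite !mul0r addr0 subrr normr0.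
apply: le_trans (ler_distD (step_op (heat (s + n%:R * step_var) x) y) _ _) _.
rewrite -[in leRHS]natr1 [leRHS]mulrDl mul1r lerD//; first exact: step_op_dist.
have nv0 : 0 <= n%:R * step_var by rewrite mulr_ge0 ?step_var_ge0.
rewrite -natr1 mulrDl mul1r addrA.
apply: le_trans (step_op_heat _ _ _) _; first by lra.
rewrite ler_wpM2l ?step_err_ge0// lef_pV2 ?posrE ?exprn_gt0 ?sqrtr_gt0//; try lra.
by rewrite lerXn2r ?nnegrE ?sqrtr_ge0// ler_wsqrtr// lerDl.
Qed.

End step_operator.

(** * The upper estimate in the central limit theorem *)

Lemma near_ge_sqrt_natM (R : realType) (v K : R) : 0 < v ->
  \forall n \near \oo, K <= Num.sqrt (n.+1%:R * v).
Proof.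
move=> v0; near=> n.
apply: le_trans (ler_norm K) _; rewrite -sqrtr_sqr ler_wsqrtr//.
rewrite -ler_pdivrMr//; apply: (@le_trans _ _ n%:R); last by rewrite ler_nat.
by near: n; exact: nbhs_infty_ger.
Unshelve. all: by end_near. Qed.

(** As [b] decreases to 0, the left side tends to [std_normal_cdf x] and the right side to
    [std_normal_cdf x + e]. Here [b] is a smoothing parameter: [2 * b] pays for the shifts of the
    barrier and of the starting point, [b ^+ 4] for the added variance, and the summand [b] for the
    telescoping error. *)
Lemma std_normal_cdf_approx (R : realType) (x e : R) : 0 < e ->
  exists2 b : R, 0 < b & 0 < std_normal_cdf ((2 * b)^-1) /\
    std_normal_cdf ((x + 2 * b) / Num.sqrt (1 + b ^+ 4)) + b <=
      (std_normal_cdf x + e) * std_normal_cdf ((2 * b)^-1).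
Proof.
move=> e0.
have cid : (fun b : R => b) @ 0^'+ --> (0 : R) by exact: cvg_within.
have c2 : (2 * b : R) @[b --> (0:R)^'+] --> (0 : R).
  by rewrite -[X in _ --> X](mulr0 2); apply: cvgMr.
have cinv : ((2 * b)^-1 : R) @[b --> (0:R)^'+] --> +oo.
  by apply/(cvgrVy (f := fun b : R => 2 * b)) => //; near=> b; rewrite mulr_gt0.
have c1 : std_normal_cdf ((2 * b)^-1) @[b --> (0:R)^'+] --> (1 : R).
  exact: cvg_comp cinv (@std_normal_cdf_y1 R).
have cb4 : (1 + b ^+ 4 : R) @[b --> (0:R)^'+] --> (1 : R).
  rewrite -[X in _ --> X]addr0; apply: cvgD; first exact: cvg_cst.
  by rewrite -[X in _ --> X](expr0n _ 4); exact: cvg_comp cid (@exprn_continuous R 4 0).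
have c3 : ((x + 2 * b) / Num.sqrt (1 + b ^+ 4)) @[b --> (0:R)^'+] --> x.
  rewrite -[X in _ --> X]divr1; apply: cvgM.
    by rewrite -[X in _ --> X]addr0; apply: cvgD => //; exact: cvg_cst.
  apply: cvgV; first exact: oner_neq0.
  rewrite -[X in _ --> X]sqrtr1; exact: cvg_comp cb4 (@sqrt_continuous R 1).
have c4 : std_normal_cdf ((x + 2 * b) / Num.sqrt (1 + b ^+ 4)) + b
    @[b --> (0:R)^'+] --> std_normal_cdf x.
  rewrite -[X in _ --> X]addr0; apply: cvgD => //.
  exact: cvg_comp c3 (@std_normal_cdf_continuous R x).
have c5 : (std_normal_cdf x + e) * std_normal_cdf ((2 * b)^-1)
    @[b --> (0:R)^'+] --> std_normal_cdf x + e.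
  by rewrite -[X in _ --> X]mulr1; apply: cvgMr.
pose m := std_normal_cdf x + e / 2.
near (0:R)^'+ => b; exists b => //; split.
  by near: b; exact: (cvgr_gt _ c1).
apply: (@le_trans _ _ m).
  by near: b; apply: (cvgr_le _ c4); rewrite /m; lra.
by near: b; apply: (cvgr_ge _ c5); rewrite /m; lra.
Unshelve. all: by end_near. Qed.

Section step_operator_limits.
Variables (R : realType) (p q r a b c : R).
Hypotheses (p0 : 0 <= p) (q0 : 0 <= q) (r0 : 0 <= r) (pqr1 : p + q + r = 1).
Hypothesis mean0 : p * a + q * b + r * c = 0.
Local Notation A := (step_op p q r a b c).
Local Notation v := (step_var p q r a b c).
Local Notation err := (step_err p q r a b c).

Lemma iter_step_op_le_cdf (x y e : R) : 0 < v -> 0 < e ->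
  \forall n \near \oo,
    iter n A (\1_`]-oo, (x * Num.sqrt (n.+1%:R * v))]) y <= std_normal_cdf x + e.
Proof.
move=> v0 e0.
have [k k0 [Phik0 Phik]] := std_normal_cdf_approx x e0.
near=> n.
set T := Num.sqrt (n.+1%:R * v).
have T1 : 1 <= T by rewrite /T; near: n; exact: near_ge_sqrt_natM.
have Ty : `|y| / k <= T by rewrite /T; near: n; exact: near_ge_sqrt_natM.
have Tk : (1 + v) / k ^+ 4 <= T by rewrite /T; near: n; exact: near_ge_sqrt_natM.
have Te : err / (v * k ^+ 7) <= T by rewrite /T; near: n; exact: near_ge_sqrt_natM.
have T0 : 0 < T by lra.
have k4 : 0 < k ^+ 4 by exact: exprn_gt0.
have T2 : T ^+ 2 = n.+1%:R * v by rewrite sqr_sqrtr// mulr_ge0// ltW.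
have kT : 1 + v <= k ^+ 4 * T ^+ 2.
  apply: le_trans (_ : k ^+ 4 * T <= _); first by rewrite mulrC -ler_pdivrMr.
  by rewrite ler_wpM2l ?(ltW k4)//; nra.
(* The extra [v] offsets the mismatch between [n] steps and the normalisation by [n.+1]: the final
   variance is exactly [T ^+ 2 * (1 + k ^+ 4)]. *)
pose s := k ^+ 4 * T ^+ 2 + v.
have s1 : 1 <= s by rewrite /s; lra.
have sv : s + n%:R * v = T ^+ 2 * (1 + k ^+ 4) by rewrite /s T2 -natr1; ring.
have lb : k ^+ 2 * T <= Num.sqrt s.
  have -> : k ^+ 2 * T = Num.sqrt ((k ^+ 2 * T) ^+ 2).
    by rewrite sqrtr_sqr ger0_norm// mulr_ge0 ?sqr_ge0 ?ltW.
  by rewrite ler_wsqrtr// exprMn -exprM /s lerDl ltW.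
have ub : Num.sqrt s <= 2 * k ^+ 2 * T.
  have -> : 2 * k ^+ 2 * T = Num.sqrt ((2 * k ^+ 2 * T) ^+ 2).
    by rewrite sqrtr_sqr ger0_norm// !mulr_ge0 ?sqr_ge0 ?ltW.
  have -> : (2 * k ^+ 2 * T) ^+ 2 = 4 * (k ^+ 4 * T ^+ 2) by ring.
  by rewrite ler_wsqrtr// /s; lra.
have ss0 : 0 < Num.sqrt s by rewrite sqrtr_gt0; lra.
(* Shifting the barrier by [k * T], which is at least [Num.sqrt s / (2 * k)], keeps the smoothed
   function above [std_normal_cdf ((2 * k)^-1)], a value near 1, on the half-line. *)
have indic_le z : std_normal_cdf ((2 * k)^-1) * \1_`]-oo, (x * T)] z <=
    heat s ((x + k) * T) z.
  rewrite indicE mem_setE in_itv/=; case: (lerP z (x * T)) => zx; last first.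
    by rewrite mulr0n mulr0 std_normal_cdf_ge0.
  rewrite mulr1n mulr1 std_normal_cdf_homo// ler_pdivlMr//.
  apply: le_trans (ler_wpM2l _ ub) _; first by rewrite invr_ge0; lra.
  have -> : (2 * k)^-1 * (2 * k ^+ 2 * T) = k * T by field; lra.
  by lra.
have := ler_iter_step_op a b c p0 q0 r0 n y indic_le.
rewrite iter_step_opZ => L1.
have := iter_step_op_heat p0 q0 r0 pqr1 mean0 n ((x + k) * T) y s1.
rewrite ler_norml => /andP[_ L2].
(* For fixed [k] the telescoped error is of order [n / T ^+ 3], hence of order [1 / T]; the bound
   [Te] makes it at most [k]. *)
have L3 : n%:R * (err / Num.sqrt s ^+ 3) <= k.
  have err0 := step_err_ge0 a b c p0 q0 r0.
  have kT0 : 0 < k ^+ 2 * T by rewrite mulr_gt0// exprn_gt0.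
  apply: le_trans (_ : n.+1%:R * (err / (k ^+ 2 * T) ^+ 3) <= _).
    rewrite ler_pM ?divr_ge0 ?exprn_ge0 ?sqrtr_ge0 ?ler_nat//.
    rewrite ler_wpM2l// lef_pV2 ?posrE ?exprn_gt0// lerXn2r ?nnegrE ?sqrtr_ge0//.
    exact: ltW.
  have -> : n.+1%:R = T ^+ 2 / v by rewrite T2 mulfK ?gt_eqF.
  have -> : T ^+ 2 / v * (err / (k ^+ 2 * T) ^+ 3) = err / (v * k ^+ 7) * k / T.
    by field; rewrite !gt_eqF.
  by rewrite ler_pdivrMr// mulrC ler_wpM2l// ltW.
(* The starting point satisfies [|y| <= k * T] and so costs a second shift by [k]. *)
have L4 : heat (s + n%:R * v) ((x + k) * T) y <=
    std_normal_cdf ((x + 2 * k) / Num.sqrt (1 + k ^+ 4)).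
  rewrite std_normal_cdf_homo// sv sqrtrM ?sqr_ge0// sqrtr_sqr gtr0_norm//.
  rewrite invfM mulrA ler_wpM2r ?invr_ge0 ?sqrtr_ge0// ler_pdivrMr//.
  have : `|y| <= T * k by rewrite -ler_pdivrMr.
  rewrite ler_norml => /andP[? _].
  by lra.
by rewrite -(ler_pM2r Phik0) mulrC; lra.
Unshelve. all: by end_near. Qed.

(** * Exponential tail bounds *)

Lemma iter_step_op_exp (l : R) (n : nat) (y : R) :
  iter n A (fun z => expR (l * z)) y =
  (p * expR (l * a) + q * expR (l * b) + r * expR (l * c)) ^+ n * expR (l * y).
Proof.
elim: n y => [|n IH] y /=; first by rewrite expr0 mul1r.
by rewrite /step_op !IH !mulrDr !expRD exprS; ring.
Qed.

(** The moment generating function [F] of the step minus [e] has value 1 and derivative [- e] at 0,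
    so it is below 1 at small positive [l]. *)
Lemma chernoff_rate (e : R) : 0 < e -> exists2 l : R, 0 < l &
  (p * expR (l * a) + q * expR (l * b) + r * expR (l * c)) * expR (- (l * e)) < 1.
Proof.
move=> e0.
pose F (l : R) := p * expR (l * (a - e)) + q * expR (l * (b - e))
  + r * expR (l * (c - e)).
have dexp (k : R) : is_derive (0 : R) 1 (fun l => expR (l * k)) k.
  have d1 : is_derive (0 : R) 1 (fun l => l * k) k.
    by apply: is_derive_eq; rewrite /GRing.scale/=; ring.
  apply: (is_derive_eq (@is_derive1_comp R expR _ 0 _ _ (is_derive_expR _) d1)).
  by rewrite mul0r expR0 mul1r.
have dF : is_derive (0 : R) 1 F (- e).
  have := dexp (a - e); have := dexp (b - e); have := dexp (c - e) => dc db da.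
  rewrite /F; apply: is_derive_eq; rewrite /GRing.scale/=.
  rewrite ?mul0r ?expR0.
  rewrite [RHS](_ : _ = p * a + q * b + r * c - (p + q + r) * e); first by ring.
  by rewrite mean0 pqr1 add0r mul1r.
have F0 : F 0 = 1 by rewrite /F !mul0r expR0 !mulr1.
have [g [gE gc g0]] := (is_derive1_caratheodory F 0 (- e)).1 dF.
have glt0 : \forall l \near (0:R)^'+, g l < 0.
  by apply: cvg_within; apply: (cvgr_lt _ gc); rewrite g0 oppr_lt0.
near (0:R)^'+ => l; exists l => //.
have -> : (p * expR (l * a) + q * expR (l * b) + r * expR (l * c)) * expR (- (l * e))
    = F l.
  by rewrite /F !mulrBr !expRD; ring.
rewrite -subr_lt0 -F0 gE subr0 nmulr_rlt0//.
by near: l.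
Unshelve. all: by end_near. Qed.

(** The indicator is dominated by [expR (l * (z - e * n))], an eigenfunction up to a constant
    factor; the ratio [z] is the quantity made less than 1 by [chernoff_rate]. *)
Lemma iter_step_op_chernoff (e y : R) : 0 < e ->
  exists C z : R, [/\ 0 <= C, 0 <= z, z < 1 &
    forall n : nat, iter n A (\1_`[(e * n%:R), +oo[) y <= C * z ^+ n].
Proof.
move=> e0; have [l l0 l1] := chernoff_rate e0.
set M := _ + _ + _ in l1.
exists (expR (l * y)), (M * expR (- (l * e))); split => //.
  by rewrite mulr_ge0 ?expR_ge0// !addr_ge0// mulr_ge0// expR_ge0.
move=> n; apply: (@le_trans _ _
    (iter n A (fun z => expR (- (l * (e * n%:R))) * expR (l * z)) y)).
  apply: ler_iter_step_op => // z.
  rewrite indicE mem_setE in_itv/= andbT -expRD.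
  case: (lerP (e * n%:R) z) => ez; last by rewrite mulr0n expR_ge0.
  by rewrite mulr1n -[leLHS]expR0 ler_expR addrC subr_ge0 ler_pM2l.
rewrite iter_step_opZ iter_step_op_exp -/M exprMn -expRM_natl.
have -> : n%:R * - (l * e) = - (l * (e * n%:R)) by ring.
by rewrite le_eqVlt; apply/orP; left; apply/eqP; ring.
Qed.

End step_operator_limits.

(** * Reflection and the two-sided limit *)

Lemma iter_step_op_reflect (R : realType) (p q r a b c : R) (f : R -> R)
    (n : nat) (y : R) :
  iter n (step_op p q r a b c) (fun z => f (- z)) y =
  iter n (step_op p q r (- a) (- b) (- c)) f (- y).
Proof.
elim: n y => [//|n IH] y /=.
by rewrite [LHS]/step_op !IH /step_op !opprD.
Qed.

Lemma step_varN (R : realType) (p q r a b c : R) :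
  step_var p q r (- a) (- b) (- c) = step_var p q r a b c.
Proof. by rewrite /step_var !sqrrN. Qed.

Lemma cvg_iter_step_op_cdf (R : realType) (p q r a b c x y : R) :
  0 <= p -> 0 <= q -> 0 <= r -> p + q + r = 1 -> p * a + q * b + r * c = 0 ->
  0 < step_var p q r a b c ->
  iter n (step_op p q r a b c)
    (\1_`]-oo, (x * Num.sqrt (n.+1%:R * step_var p q r a b c))]) y
    @[n --> \oo] --> std_normal_cdf x.
Proof.
move=> p0 q0 r0 pqr1 mean0 v0; apply/cvgrPdist_le => e e0.
have mean0' : p * - a + q * - b + r * - c = 0 by lra.
have v0' : 0 < step_var p q r (- a) (- b) (- c) by rewrite step_varN.
near=> n; rewrite ler_norml; apply/andP; split.
  have : iter n (step_op p q r a b c)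
    (\1_`]-oo, (x * Num.sqrt (n.+1%:R * step_var p q r a b c))]) y
      <= std_normal_cdf x + e by near: n; exact: iter_step_op_le_cdf.
  by lra.
(* The lower bound is the upper bound for the reflected walk at [- x], combined with the symmetry of
   the normal law. *)
have : iter n (step_op p q r (- a) (- b) (- c)) (\1_`]-oo,
    (- x * Num.sqrt (n.+1%:R * step_var p q r (- a) (- b) (- c)))]) (- y)
    <= std_normal_cdf (- x) + e by near: n; exact: iter_step_op_le_cdf.
rewrite -iter_step_op_reflect step_varN std_normal_cdfN mulNr.
set T := x * _.
have := @iter_step_op_cst R p q r a b c pqr1 1 n y.
(* The half-lines [z <= T] and [z >= T] cover the line, so their two averages sum to at least 1. *)
have : iter n (step_op p q r a b c) (cst 1) y <=
  iter n (step_op p q r a b c) (fun z => \1_`]-oo, T] z + \1_`]-oo, (- T)] (- z)) y.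
  apply: ler_iter_step_op => // z.
  rewrite !indicE !mem_setE !in_itv/= lerN2.
  by case: (leP z T) => zT; rewrite ?(ltW zT) ?lerDl ?add0r.
have -> : iter n (step_op p q r a b c)
    (fun z => \1_`]-oo, T] z + \1_`]-oo, (- T)] (- z)) y =
  iter n (step_op p q r a b c) (\1_`]-oo, T]) y +
  iter n (step_op p q r a b c) (fun z => \1_`]-oo, (- T)] (- z)) y.
  elim: (n) (y) => [//|m IH] w /=.
  by rewrite /step_op !IH; ring.
by lra.
Unshelve. all: by end_near. Qed.

(** * Conditioning and the law of the independent walk *)

Lemma three_point_law_split (d : measure_display) (T : measurableType d) (R : realType)
    (P : probability T R) (Z : T -> R) (p q r : R) (D : set T) :
  measurable_fun setT Z -> three_point_law P Z p q r -> p + q + r = 1 ->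
  measurable D ->
  P D = (P (Z @^-1` [set 1%R] `&` D) + P (Z @^-1` [set (-1)%R] `&` D)
         + P (Z @^-1` [set 0%R] `&` D))%E.
Proof.
move=> mZ [Z1 ZN1 Z0] pqr1 mD.
have mpre (t : R) : measurable (Z @^-1` [set t]).
  by rewrite -[X in measurable X]setTI; exact: mZ.
have disj (s t : R) : s != t -> Z @^-1` [set s] `&` Z @^-1` [set t] = set0.
  by move=> st; apply/seteqP; split => // w [/= -> E]; move/eqP: st.
have N11 : (1 : R) != -1 by rewrite gt_eqF//; lra.
have N10 : (1 : R) != 0 by exact: oner_neq0.
have NN10 : (-1 : R) != 0 by rewrite oppr_eq0 oner_eq0.
have addU E : measurable E -> P ((Z @^-1` [set 1%R] `|` Z @^-1` [set (-1)%R]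
      `|` Z @^-1` [set 0%R]) `&` E) = (P (Z @^-1` [set 1%R] `&` E)
    + P (Z @^-1` [set (-1)%R] `&` E) + P (Z @^-1` [set 0%R] `&` E))%E.
  move=> mE; rewrite !setIUl measureU; first last.
  - rewrite -setIUl setIACA setIid setIUl !disj// setU0 set0I//.
  - exact: measurableI.
  - by apply: measurableU; exact: measurableI.
  rewrite measureU//; try exact: measurableI.
  by rewrite setIACA disj// set0I.
set S := (_ `|` _ `|` _) in addU.
have mS : measurable S by apply: measurableU => //; exact: measurableU.
(* The three values carry total mass [p + q + r = 1], so the part of [D] outside [S] is null. *)
have PS : P S = 1%E.
  have := addU setT measurableT; rewrite !setIT Z1 ZN1 Z0 => ->.
  by rewrite -!EFinD pqr1.
rewrite -addU// [S `&` D]setIC (measureDI P mD mS).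
rewrite -[RHS]add0e; congr (_ + _)%E.
apply/eqP; rewrite eq_le measure_ge0 andbT.
apply: (@le_trans _ _ (P (~` S))).
  apply: le_measure; rewrite ?inE; first exact: measurableD.
    exact: measurableC.
  by move=> w [].
by rewrite probability_setC// PS subee.
Qed.

Section independent_walk.
Variables (d : measure_display) (T : measurableType d) (R : realType).
Variables (P : probability T R) (Y : nat -> T -> R) (p q r : R) (g : R -> R).
Hypothesis mY : forall i, measurable_fun setT (Y i).
Hypothesis indepY : mutually_independent P Y.
Hypothesis lawY : forall i, (0 < i)%N -> three_point_law P (Y i) p q r.
Hypothesis pqr1 : p + q + r = 1.
Hypothesis mg : measurable_fun setT g.

Lemma measurable_walk (y : R) (k l : nat) (V : set R) : measurable V ->
  measurable [set w | V (y + \sum_(k <= i < l) g (Y i w))].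
Proof.
move=> mV; rewrite -[X in measurable X]setTI.
have : measurable_fun setT (fun w => y + \sum_(k <= i < l) g (Y i w)).
  apply: measurable_funD; first exact: measurable_cst.
  by apply: measurable_sum => i; exact: measurableT_comp.
by apply.
Qed.

(* First-step analysis: condition on the value of [Y k]. *)
Lemma prob_walk (n k : nat) (I : seq nat) (B : nat -> set R) (y : R) (V : set R) :
  uniq I -> (forall i, i \in I -> (i < k)%N) -> (0 < k)%N ->
  (forall i, measurable (B i)) -> measurable V ->
  P ((\big[setI/setT]_(i <- I) (Y i @^-1` B i)) `&`
     [set w | V (y + \sum_(k <= i < k + n) g (Y i w))]) =
  (P (\big[setI/setT]_(i <- I) (Y i @^-1` B i)) *
   (iter n (step_op p q r (g 1) (g (-1)) (g 0)) (\1_V) y)%:E)%E.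
Proof.
elim: n k I B y => [|n IH] k I B y uI Ik k0 mB mV /=.
  have -> : [set w | V (y + \sum_(k <= i < k + 0) g (Y i w))] = [set w | V y].
    by apply/funext => w /=; rewrite addn0 big_geq// addr0.
  rewrite indicE; case: (boolP (y \in V)) => [|/negP]; rewrite inE => Vy.
  - rewrite mulr1n mule1; congr (P _).
    by apply/seteqP; split => [w []//|w ?]; split.
  - rewrite mulr0n mule0 -(measure0 P); congr (P _).
    by apply/seteqP; split => [w []//|].
have kI : k \notin I by apply/negP => /Ik; rewrite ltnn.
set D := \big[setI/setT]_(i <- I) (Y i @^-1` B i).
have mD : measurable D.
  apply: bigsetI_measurable => i _.
  by rewrite -[X in measurable X]setTI; exact: mY.
set E := [set w | _].
have mE : measurable E by exact: measurable_walk.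
have [Pk1 PkN1 Pk0] := lawY k0.
have cond (t : R) : P (Y k @^-1` [set t] `&` (D `&` E)) =
    (P (Y k @^-1` [set t]) * P D *
     (iter n (step_op p q r (g 1) (g (-1)) (g 0)) (\1_V) (y + g t))%:E)%E.
  (* The constraint [Y k = t] joins those on the earlier indices, and the induction hypothesis
     applies to the walk that restarts at index [k.+1] from [y + g t]. *)
  pose B' i := if i == k then [set t] else B i.
  have mB' i : measurable (B' i) by rewrite /B'; case: ifP.
  have ukI : uniq (k :: I) by rewrite /= kI.
  have kIk i : i \in k :: I -> (i < k.+1)%N.
    by rewrite inE => /predU1P[->//|/Ik /ltnW].
  have DE : \big[setI/setT]_(i <- I) (Y i @^-1` B' i) = D.
    rewrite /D; apply: eq_big_seq => i iI; rewrite /B'.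
    by case: eqP iI => // ->; rewrite (negbTE kI).
  have DkE : \big[setI/setT]_(i <- k :: I) (Y i @^-1` B' i) = Y k @^-1` [set t] `&` D.
    by rewrite big_cons DE /B' eqxx.
  have PDk : P (Y k @^-1` [set t] `&` D) = (P (Y k @^-1` [set t]) * P D)%E.
    by rewrite -DkE indepY// big_cons /B' eqxx -/B' -indepY// DE.
  rewrite -PDk -DkE -(IH k.+1)// DkE setIA; congr (P _).
  have YkE w : Y k w = t -> E w =
      V (y + g t + \sum_(k.+1 <= i < k.+1 + n) g (Y i w)).
    by move=> Yk; rewrite /E/= addnS big_ltn ?ltnS ?leq_addr// Yk addrA addSn.
  by apply/seteqP; split => w [[/= Yk Dw]]; rewrite (YkE _ Yk).
have := @three_point_law_split _ _ _ P (Y k) p q r (D `&` E) (mY k) (lawY k0) pqr1.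
rewrite !cond => ->; last exact: measurableI.
rewrite Pk1 PkN1 Pk0 /step_op !EFinD !EFinM.
have PD : P D \is a fin_num by exact: fin_num_measure.
by rewrite -(fineK PD) -!EFinM -!EFinD -?EFinM; congr EFin; ring.
Qed.

End independent_walk.

(** * Borel-Cantelli for geometrically small events *)

Lemma ae_eventually_notin (d : measure_display) (T : measurableType d) (R : realType)
    (P : probability T R) (F : nat -> set T) (C z : R) :
  (forall n, measurable (F n)) -> 0 <= C -> 0 <= z -> z < 1 ->
  (forall n, (P (F n) <= (C * z ^+ n)%:E)%E) ->
  {ae P, forall w, \forall n \near \oo, ~ F n w}.
Proof.
move=> mF C0 z0 z1 PF.
have mlim : measurable (lim_sup_set F).
  by apply: bigcapT_measurable => n; apply: bigcup_measurable => k _; exact: mF.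
have : P (lim_sup_set F) = 0%E.
  apply: lim_sup_set_cvg0 => //.
  apply: (@le_lt_trans _ _ (\sum_(n <oo) (geometric C z n)%:E)%E).
    by apply: lee_nneseries => // n _; exact: PF.
  have cg : series (geometric C z) @ \oo --> C / (1 - z).
    by apply: cvg_geometric_series; rewrite ger0_norm.
  have -> : (\sum_(n <oo) (geometric C z n)%:E)%E = (C / (1 - z))%:E.
    apply/cvg_lim => //.
    have -> : (fun n => \sum_(0 <= i < n) (geometric C z i)%:E)%E =
        EFin \o series (geometric C z).
      by apply/funext => n /=; rewrite sumEFin.
    by apply: cvg_EFin => //; exact: nearW.
  exact: ltry.
move=> /(negligibleP _ mlim).
apply: negligibleS => w /= Fw n _; apply: contrapT => Fn; apply: Fw.
exists n => // k /= nk Fk; apply: Fn; exists k => //.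
Qed.

(** * Application to the elephant random walk *)

Lemma erw_sum_centered (T : Type) (R : realType) (X1 : T -> R) (eta : nat -> T -> R)
    (m : R) (n : nat) (w : T) :
  erw_sum X1 eta n.+1 w - n.+1%:R * m * X1 w =
  X1 w * (1 - m + \sum_(1 <= i < 1 + n) (erw_family X1 eta i w - m)).
Proof.
elim: n => [|n IH].
  by rewrite /erw_sum big_nat1 big_geq// /erw_step/=; ring.
rewrite /erw_sum big_nat_recr//= -/(erw_sum X1 eta n.+1 w).
rewrite addnS [X in _ = _ * (_ + X)]big_nat_recr//= add1n.
(* Entry [n.+1] of the family is [eta n.+2], so the numbering matches the new step of the sum. *)
rewrite [erw_step _ _ _ _]/erw_step /= [erw_family _ _ n.+1]/erw_family /=.
by rewrite addrA mulrDr -IH -[n.+2%:R]natr1; ring.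
Qed.

Section elephant.
Variables (R : realType) (d : measure_display) (T : measurableType d).
Variables (P : probability T R) (p q r : R) (X1 : T -> R) (eta : nat -> T -> R).
Hypotheses (p01 : 0 < p < 1) (q01 : 0 < q < 1) (r01 : 0 < r < 1).
Hypothesis pqr1 : p + q + r = 1.
Hypotheses (mX1 : measurable_fun setT X1) (meta : forall n, measurable_fun setT (eta n)).
Hypothesis indep : mutually_independent P (erw_family X1 eta).
Hypothesis lawX1 : three_point_law P X1 p q r.
Hypothesis laweta : forall n, (2 <= n)%N -> three_point_law P (eta n) p q r.

Local Notation Y := (erw_family X1 eta).
Let m := p - q.
Let U (n : nat) (w : T) : R := 1 - m + \sum_(1 <= i < 1 + n) (Y i w - m).
(** Transition operator of [s * U]. The signs 1 and -1 serve as the nonzero values of [X1] in (a),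
    and as the two tails of [U] in (b). *)
Let A (s : R) := step_op p q r (s * (1 - m)) (s * (- 1 - m)) (s * (0 - m)).
Let v : R := p + q - (p - q) ^+ 2.

Let p0 : 0 <= p. Proof. by case/andP: p01 => /ltW. Qed.
Let q0 : 0 <= q. Proof. by case/andP: q01 => /ltW. Qed.
Let r0 : 0 <= r. Proof. by case/andP: r01 => /ltW. Qed.

Let mY i : measurable_fun setT (Y i).
Proof. by rewrite /erw_family; case: eqP. Qed.

Let lawY i : (0 < i)%N -> three_point_law P (Y i) p q r.
Proof. by case: i => // i _; exact: laweta. Qed.

Let mean0 (s : R) :
  p * (s * (1 - m)) + q * (s * (- 1 - m)) + r * (s * (0 - m)) = 0.
Proof.
rewrite [LHS](_ : _ = s * m * (1 - (p + q + r))); last by rewrite /m; ring.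
by rewrite pqr1 subrr mulr0.
Qed.

Let var (s : R) : s ^+ 2 = 1 ->
  step_var p q r (s * (1 - m)) (s * (- 1 - m)) (s * (0 - m)) = v.
Proof.
move=> s1; rewrite /step_var !exprMn s1 /v /m.
have -> : r = 1 - p - q by rewrite -pqr1; ring.
by ring.
Qed.

(** Since [0 < p + q < 1], one has [(p - q) ^+ 2 <= (p + q) ^+ 2 < p + q]. *)
Let v0 : 0 < v.
Proof.
rewrite /v; move/andP: p01 => [? _]; move/andP: q01 => [? _].
move/andP: r01 => [? _].
have ? : p + q < 1 by rewrite -pqr1; lra.
by nra.
Qed.

Let mg (s : R) : measurable_fun setT (fun z : R => s * (z - m)).
Proof.
apply: measurable_funM; first exact: measurable_cst.
by apply: measurable_funB; [exact: measurable_id|exact: measurable_cst].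
Qed.

Let UE (s : R) (n : nat) (w : T) :
  s * U n w = s * (1 - m) + \sum_(1 <= i < 1 + n) s * (Y i w - m).
Proof. by rewrite /U mulrDr mulr_sumr. Qed.

Let mU (s : R) (n : nat) (V : set R) : measurable V -> measurable [set w | V (s * U n w)].
Proof.
move=> mV; have := measurable_walk mY (mg s) (s * (1 - m)) 1 (1 + n) mV.
by congr measurable; apply/funext => w /=; rewrite UE.
Qed.

Let prob_U (s : R) (n : nat) (V : set R) : measurable V ->
  P [set w | V (s * U n w)] = (iter n (A s) (\1_V) (s * (1 - m)))%:E.
Proof.
move=> mV.
have := @prob_walk _ _ _ P Y p q r _ mY indep lawY pqr1 (mg s) n 1 [::]
  (fun=> setT) (s * (1 - m)) V.
rewrite big_nil setTI probability_setT mul1e => <- //.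
by congr (P _); apply/funext => w /=; rewrite UE.
Qed.

(** Entry 0 of the family is [X1], while the walk uses the entries from 1 on; the past constraint is
    therefore placed on the single index 0. *)
Let prob_X1U (e s : R) (n : nat) (V : set R) : measurable V ->
  P (X1 @^-1` [set e] `&` [set w | V (s * U n w)]) =
  (P (X1 @^-1` [set e]) * (iter n (A s) (\1_V) (s * (1 - m)))%:E)%E.
Proof.
move=> mV.
have := @prob_walk _ _ _ P Y p q r _ mY indep lawY pqr1 (mg s) n 1 [:: 0%N]
  (fun=> [set e]) (s * (1 - m)) V.
rewrite big_seq1 => <- //; last by move=> i; rewrite inE => /eqP ->.
by congr (P (_ `&` _)); apply/funext => w /=; rewrite UE.
Qed.

Let W (n : nat) (w : T) : R :=
  (erw_sum X1 eta n w - n%:R * (p - q) * X1 w)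
    / Num.sqrt (n%:R * (p + q - (p - q) ^+ 2)).

Let WE (n : nat) (w : T) : W n.+1 w = X1 w * U n w / Num.sqrt (n.+1%:R * v).
Proof. by rewrite /W erw_sum_centered. Qed.

Let prob_W (n : nat) (x : R) :
  P (W n.+1 @^-1` `]-oo, x]) =
  (p * iter n (A 1) (\1_`]-oo, (x * Num.sqrt (n.+1%:R * v))]) (1 * (1 - m))
   + q * iter n (A (-1)) (\1_`]-oo, (x * Num.sqrt (n.+1%:R * v))]) (-1 * (1 - m))
   + r * (if 0 <= x then 1 else 0))%:E.
Proof.
have mW : measurable (W n.+1 @^-1` `]-oo, x]).
  have mW : measurable_fun setT (fun w => X1 w * (1 * U n w) / Num.sqrt (n.+1%:R * v)).
    apply: measurable_funM; last exact: measurable_cst.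
    by apply: measurable_funM => // _ V mV; rewrite setTI; exact: mU.
  have := mW measurableT `]-oo, x]%classic (measurable_itv _).
  by rewrite setTI; congr measurable; apply/funext => w /=; rewrite WE mul1r.
have T0 : 0 < Num.sqrt (n.+1%:R * v) by rewrite sqrtr_gt0 mulr_gt0.
have cond (e : R) : X1 @^-1` [set e] `&` W n.+1 @^-1` `]-oo, x] =
    X1 @^-1` [set e] `&`
      [set w | `]-oo, (x * Num.sqrt (n.+1%:R * v))]%classic (e * U n w)].
  by apply/seteqP; split => w [/= Xe]; rewrite WE Xe !in_itv/= ler_pdivrMr.
rewrite (three_point_law_split mX1 lawX1 pqr1 mW) !cond.
have [X1p X1q X1r] := lawX1.
rewrite (@prob_X1U 1)// (@prob_X1U (-1))// X1p X1q !EFinD !EFinM; congr (_ + _)%E.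
(* Where [X1] vanishes, [W] is 0, so the event is all of that set or empty according to the sign of
   [x]; this is the point mass. *)
have [x0|x0] := lerP 0 x.
  rewrite mule1 -X1r; congr (P _); apply/seteqP; split => [w []//|w Xw]; split => //=.
  by rewrite in_itv/= mul0r mulr_ge0// ltW.
rewrite mule0 -(measure0 P); congr (P _); apply/seteqP; split => // w [_ /=].
by rewrite in_itv/= mul0r pmulr_lge0// leNgt x0.
Qed.

Lemma erw_cvg_in_distribution : cvg_in_distribution P W
  (fun x => (p + q) * std_normal_cdf x + r * (if 0 <= x then 1 else 0)).
Proof.
move=> x _; rewrite -cvg_shiftS.
have -> : [sequence fine (P (W n.+1 @^-1` `]-oo, x]))]_n = fun n : nat =>
   (p * iter n (A 1) (\1_`]-oo, (x * Num.sqrt (n.+1%:R * v))]) (1 * (1 - m))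
   + q * iter n (A (-1)) (\1_`]-oo, (x * Num.sqrt (n.+1%:R * v))]) (-1 * (1 - m))
   + r * (if 0 <= x then 1 else 0)).
  by apply/funext => n /=; rewrite prob_W.
have lim (s y : R) : s ^+ 2 = 1 ->
    iter n (A s) (\1_`]-oo, (x * Num.sqrt (n.+1%:R * v))]) y
      @[n --> \oo] --> std_normal_cdf x.
  move=> s1; rewrite -(var s1); apply: cvg_iter_step_op_cdf => //.
  by rewrite (var s1).
apply: cvgD; last exact: cvg_cst.
(* The walks for [X1 = 1] and [X1 = -1] have the same variance, hence the same normal limit, and
   their weights add up to [p + q]. *)
rewrite mulrDl; apply: cvgD; apply: cvgMr; apply: lim; first by rewrite expr1n.
by rewrite sqrrN expr1n.
Qed.

Lemma erw_ae_cvg0 : {ae P, forall w,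
  (fun n => (erw_sum X1 eta n w - n%:R * (p - q) * X1 w) / n%:R) @ \oo --> (0 : R)}.
Proof.
(* The thresholds [j.+1%:R^-1] are countably many, so one null set serves them all. *)
have tail (s : R) (j : nat) : {ae P, forall w, \forall n \near \oo,
    ~ (j.+1%:R^-1 * n%:R <= s * U n w)}.
  have j0 : 0 < (j.+1%:R^-1 : R) by rewrite invr_gt0.
  have [C [z [C0 z0 z1 Cz]]] :=
    iter_step_op_chernoff p0 q0 r0 pqr1 (mean0 s) (s * (1 - m)) j0.
  pose F n := [set w | `[(j.+1%:R^-1 * n%:R), +oo[%classic (s * U n w)].
  have mF n : measurable (F n) by exact: mU.
  have PF n : (P (F n) <= (C * z ^+ n)%:E)%E by rewrite /F prob_U// lee_fin.
  have := ae_eventually_notin mF C0 z0 z1 PF.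
  apply: filterS => w; apply: filterS => n.
  by rewrite /F/= in_itv/= andbT.
have := ae_foralln (tail 1); have := ae_foralln (tail (-1)).
apply: filterS2 => w tN tP.
rewrite -cvg_shiftS.
have -> : [sequence (erw_sum X1 eta n.+1 w - n.+1%:R * (p - q) * X1 w) / n.+1%:R]_n =
    fun n => X1 w * (U n w / n.+1%:R).
  by apply/funext => n /=; rewrite erw_sum_centered mulrA.
suff : U n w / n.+1%:R @[n --> \oo] --> (0 : R).
  by move=> /(cvgMr (a := X1 w)); rewrite mulr0.
apply/cvgr0Pnorm_le => e e0.
near \oo => j; near=> n.
have je : (j.+1%:R^-1 : R) <= e.
  by near: j; have := near_infty_natSinv_lt (PosNum e0); apply: filterS => k /ltW.
have n0 : 0 < (n.+1%:R : R) by [].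
rewrite normrM normfV (gtr0_norm n0) ler_pdivrMr//.
(* The tail bound scales with the [n] steps of [U n], the quotient with [n.+1]; the difference goes
   in the favourable direction. *)
apply: (@le_trans _ _ (j.+1%:R^-1 * n%:R)); last first.
  by rewrite ler_pM// ler_nat.
have /negP : ~ (j.+1%:R^-1 * n%:R <= 1 * U n w) by near: n; exact: tP.
have /negP : ~ (j.+1%:R^-1 * n%:R <= -1 * U n w) by near: n; exact: tN.
by rewrite -!ltNge mul1r mulN1r => /ltW UN /ltW UP; rewrite ler_norml lerNl UN.
Unshelve. all: by end_near. Qed.

End elephant.

Theorem theorem5p3 (R : realType) (d : measure_display) (T : measurableType d)
  (P : probability T R) (p q r : R) (X1 : T -> R) (eta : nat -> T -> R) :
  0 < p < 1 -> 0 < q < 1 -> 0 < r < 1 -> p + q + r = 1 ->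
  measurable_fun setT X1 -> (forall n, measurable_fun setT (eta n)) ->
  mutually_independent P (erw_family X1 eta) ->
  three_point_law P X1 p q r ->
  (forall n, (2 <= n)%N -> three_point_law P (eta n) p q r) ->
  cvg_in_distribution P
    (fun n w => (erw_sum X1 eta n w - n%:R * (p - q) * X1 w)
                / Num.sqrt (n%:R * (p + q - (p - q) ^+ 2)))
    (fun x => (p + q) * std_normal_cdf x + r * (if 0 <= x then 1 else 0))
  /\
  {ae P, forall w, (fun n => (erw_sum X1 eta n w - n%:R * (p - q) * X1 w)
                              / n%:R) @ \oo --> (0 : R)}.
Proof.
move=> p01 q01 r01 pqr1 mX1 meta indep lawX1 laweta; split.
  exact: erw_cvg_in_distribution.
exact: (erw_ae_cvg0 p01 q01 r01 pqr1 mX1 meta indep lawX1 laweta).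
Qed.
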